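(* Let $n\ge 2$, let $K_1,K_2\subset\mathbb{R}^n$ be proper cones, and let $L(A)=XAY$ be a linear map on $M_n$ for fixed $X,Y\in M_n$. Then $L(MS(K_1,K_2))\subset MS(K_1,K_2)$ if and only if either $X$ is $K_2$-inverse nonnegative and $Y$ is $K_1$-inverse nonnegative, or $-X$ is $K_2$-inverse nonnegative and $-Y$ is $K_1$-inverse nonnegative.
   Context: $M_n$ is the space of real $n\times n$ matrices. A convex cone $K\subseteq\mathbb{R}^n$ is a set with $K+K\subseteq K$ and $\alpha K\subseteq K$ for all $\alpha\ge 0$; it is proper if it is closed, pointed ($K\cap -K=\{0\}$) and has nonempty interior $K^\circ$. A matrix $A\in M_n$ is $(K_1,K_2)$-semipositive if there exists $x\in K_1^\circ$ with $Ax\in K_2^\circ$. It is $(K_1,K_2)$-minimally semipositive if it is $(K_1,K_2)$-semipositive and has a left inverse $B\in M_n$ ($BA=I_n$) with $B(K_2)\subseteq K_1$; the set of such matrices is $MS(K_1,K_2)$. A square matrix $Y$ is $K$-inverse nonnegative if $Y$ is invertible and $Y^{-1}(K)\subseteq K$. *)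

(* Defs.v *)
From HB Require Import structures.
From mathcomp Require Import all_boot all_order all_algebra.
From mathcomp Require Import all_classical all_reals all_analysis.

Set Implicit Arguments.
Unset Strict Implicit.
Unset Printing Implicit Defensive.

Import Order.TTheory GRing.Theory Num.Theory.
Import numFieldNormedType.Exports.

Local Open Scope classical_set_scope.
Local Open Scope ring_scope.

Section Cones.
Context {R : realType} {n : nat}.
Implicit Types (K : set 'cV[R]_n) (A B X Y : 'M[R]_n).

Definition convex_cone K :=
  (forall x y, K x -> K y -> K (x + y)) /\
  (forall (a : R) x, 0 <= a -> K x -> K (a *: x)).

Definition proper_cone K :=
  [/\ convex_cone K,
      closed K,
      K `&` [set - x | x in K] = [set 0]
    & K° !=set0].

Definition semipositive K1 K2 A :=
  exists2 x : 'cV[R]_n, K1° x & K2° (A *m x).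

Definition minimally_semipositive K1 K2 A :=
  semipositive K1 K2 A /\
  exists2 B : 'M[R]_n, B *m A = 1%:M & [set B *m x | x in K2] `<=` K1.

Definition MS K1 K2 : set 'M[R]_n := [set A | minimally_semipositive K1 K2 A].

Definition inverse_nonnegative K Y :=
  Y \in unitmx /\ [set invmx Y *m x | x in K] `<=` K.

End Cones.

(* Main.v *)
Require Import Defs.
From HB Require Import structures.
From mathcomp Require Import all_boot all_order all_algebra.
From mathcomp Require Import all_classical all_reals all_analysis.
From mathcomp Require Import ring lra.

(** Passing to inverses linearizes the problem.  A matrix A is in MS(K1, K2)
iff it is invertible and its inverse Z maps K2 into K1 ([MS_invmxP]); the strict
feasibility of A comes for free, because the invertible Z maps interior points
of K2 to interior points of K1.  As X A Y has inverse Y^-1 Z X^-1, sufficiency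
is immediate, and a simultaneous change of sign of X and Y changes nothing.

For necessity write P = Y^-1 and Q = X^-1, which exist because MS(K1, K2) is not
empty ([exists_unitmx_cone_map]).  The hypothesis says that P Z Q maps K2 into
K1 for every invertible Z which does.  The invertible such Z are dense in the
closed cone of all matrices mapping K2 into K1, so the conclusion extends to
the singular Z = u f, where u is in K1 and the row vector f is in the dual of
K2 ([cone_map_rank1]).  For y in K2 this reads: the scalar f Q y times the
vector P u lies in K1.

Some scalar f Q y is nonzero.  If one is positive, then P maps K1 into itself;
no such scalar can then be negative, since -P would also preserve K1, against
pointedness; so all of them are nonnegative and the bipolar theorem says that Q
preserves K2 ([cone_maps_of_pos]).  If one is negative, the same argument
applies to -P and -Q.

The convex analysis used is the bipolar theorem for closed convex cones
([bipolar]), obtained from the closest point of the cone to an outside point. *)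

Set Implicit Arguments.
Unset Strict Implicit.
Unset Printing Implicit Defensive.

Import Order.TTheory GRing.Theory Num.Theory.
Import numFieldNormedType.Exports.

Local Open Scope classical_set_scope.
Local Open Scope ring_scope.

(** * Continuity of matrix operations *)

Lemma sum_continuous (R : numFieldType) (T : topologicalType) (I : Type)
    (r : seq I) (F : I -> T -> R) :
  (forall i, continuous (F i)) -> continuous (fun x => \sum_(i <- r) F i x).
Proof.
move=> Fc; apply: continuous_big; last by move=> i _; exact: Fc.
exact: add_continuous.
Qed.

Lemma mx_continuous (R : numFieldType) m n (T : topologicalType)
    (f : T -> 'M[R]_(m, n)) :
  (forall i j, continuous (fun x => f x i j)) -> continuous f.
Proof.
move=> fc x A [P PM PA].
apply: (@filterS _ (nbhs x) _ [set y | forall i j, P i j (f y i j)]).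
  by move=> y Py; apply: PA.
by apply: filter_forall => i; apply: filter_forall => j; exact: fc (PM i j).
Qed.

Lemma mulmx_continuous (R : numFieldType) m n p (A : 'M[R]_(m, n)) :
  continuous (mulmx A : 'M[R]_(n, p) -> 'M[R]_(m, p)).
Proof.
apply: mx_continuous => i j; under eq_fun do rewrite mxE.
apply: sum_continuous => k x; apply: continuousM; first exact: cst_continuous.
exact: coord_continuous.
Qed.

Lemma trmx_continuous (R : numFieldType) m n :
  continuous (@trmx _ m n : 'M[R]_(m, n) -> 'M[R]_(n, m)).
Proof.
apply: mx_continuous => i j; under eq_fun do rewrite mxE.
exact: coord_continuous.
Qed.

(** * Euclidean norm and closest points *)

Section SquaredNorm.
Variables (R : realType) (n : nat).
Implicit Types x y h p : 'cV[R]_n.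

(** The square of the Euclidean norm, which, unlike the norm carried by the type
of matrices (the maximum norm), comes from an inner product. *)
Definition sqnorm x : R := (x^T *m x) 0 0.

Lemma sqnormE x : sqnorm x = \sum_i x i 0 ^+ 2.
Proof. by rewrite /sqnorm mxE; apply: eq_bigr => i _; rewrite mxE. Qed.

Lemma sqnorm_ge0 x : 0 <= sqnorm x.
Proof. by rewrite sqnormE sumr_ge0// => i _; exact: sqr_ge0. Qed.

Lemma sqnorm_le0 x : sqnorm x <= 0 -> x = 0.
Proof.
move=> x0; have /eqP : sqnorm x = 0 by apply/eqP; rewrite eq_le x0 sqnorm_ge0.
rewrite sqnormE psumr_eq0 => [/allP xi|i _]; last exact: sqr_ge0.
apply/colP => i; rewrite mxE; apply/eqP.
by rewrite -sqrf_eq0; apply: xi; rewrite mem_index_enum.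
Qed.

Lemma sqr_coord_le x i : x i 0 ^+ 2 <= sqnorm x.
Proof.
rewrite sqnormE (bigD1 i)//= lerDl sumr_ge0// => j _; exact: sqr_ge0.
Qed.

Lemma sqnormDZ p h (t : R) :
  sqnorm (p + t *: h) = sqnorm p + t * (2 * (p^T *m h) 0 0 + t * sqnorm h).
Proof.
have hp : (h^T *m p) 0 0 = (p^T *m h) 0 0.
  by rewrite -[p in LHS]trmxK -trmx_mul mxE.
have pth : (p + t *: h)^T = p^T + t *: h^T by rewrite linearD linearZ.
rewrite /sqnorm pth mulmxDl !mulmxDr -!scalemxAl -!scalemxAr.
do !rewrite [fun_of_matrix (_ + _) _ _]mxE.
do !rewrite [fun_of_matrix (_ *: _) _ _]mxE.
by rewrite hp; ring.
Qed.

Lemma sqnorm_continuous : continuous sqnorm.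
Proof.
rewrite (_ : sqnorm = fun x => \sum_i x i 0 ^+ 2); last first.
  by apply/funext => x; exact: sqnormE.
by apply: sum_continuous => i x; apply: continuousM; exact: coord_continuous.
Qed.

End SquaredNorm.

Lemma ge0_of_small_perturbation (R : realFieldType) (a b : R) :
  (forall t, 0 < t -> t <= 1 -> 0 <= a + t * b) -> 0 <= a.
Proof.
move=> ab; rewrite leNgt; apply/negP => a0.
(* At t = - a / (2 d) the value is at most a - a / 2 < 0, because b <= d; and
t <= 1 because - a <= d. *)
pose d := `|b| - a.
have d0 : 0 < d by rewrite /d; have := normr_ge0 b; lra.
have := ab (- a / (2 * d)).
have tE : - a / (2 * d) * d = - a / 2 by field; rewrite gt_eqF.
have t0 : 0 < - a / (2 * d) by rewrite divr_gt0//; lra.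
move: (- a / (2 * d)) tE t0 => t tE t0 /(_ t0) H.
have bd : b <= d by rewrite /d; have := ler_norm b; lra.
have : 0 <= a + t * b.
  apply: H; rewrite -(ler_pM2r d0) tE mul1r /d; have := normr_ge0 b; lra.
have : t * b <= t * d by rewrite ler_pM2l.
lra.
Qed.

(** The points of K at least as close to z as a given point of K form a compact
set, on which the distance attains its minimum. *)
Lemma closest_point (R : realType) n (K : set 'cV[R]_n) (z : 'cV[R]_n) :
  closed K -> K !=set0 ->
  exists2 k, K k & forall x, K x -> sqnorm (k - z) <= sqnorm (x - z).
Proof.
move=> Kcl [k0 Kk0]; pose d (x : 'cV[R]_n) := sqnorm (x - z).
have dc : continuous d.
  have zc : continuous (fun x : 'cV[R]_n => x - z).
    by move=> x; exact: cvgB cvg_id (cvg_cst z).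
  by move=> x; exact: continuous_comp (zc x) (@sqnorm_continuous R n _).
have dtc : continuous (fun v : 'rV[R]_n => d v^T).
  by move=> v; exact: continuous_comp (@trmx_continuous R 1 n v) (dc _).
(* Transposing makes boxes compact through [rV_compact]. *)
pose A := [set v : 'rV[R]_n | K v^T] `&` [set v | d v^T <= d k0].
have Acl : closed A.
  apply: closedI.
    by apply: (preimage_closed _ Kcl) => v _; exact: trmx_continuous.
  apply: (@preimage_closed _ _ (fun v => d v^T) [set r | r <= d k0]).
    by move=> v _; exact: dtc.
  exact: closed_le.
(* d k0 bounds the square of v 0 i - z i 0, hence d k0 + 1 bounds its absolute
value: r <= (r + 1)^2 for r >= 0. *)
have Aco : compact A.
  apply: (subclosed_compact Acl (rV_compact (fun i =>
    @segment_compact R (z i 0 - (d k0 + 1)) (z i 0 + (d k0 + 1))))).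
  move=> v [_ vd] i /=; rewrite in_itv/=.
  have := le_trans (sqr_coord_le _ i) vd; rewrite !mxE.
  have := sqnorm_ge0 (k0 - z); rewrite -/(d k0).
  by move: (v _ _) (z _ _) (d k0) => a b c c0 abc; apply/andP; split; nra.
have A0 : A !=set0 by exists k0^T; rewrite /A/= trmxK.
have [|v /set_mem [Kv vk0] vmin] :=
    compact_EVT_min A0 Aco (f := fun v => d v^T).
  exact: continuous_subspaceT.
exists v^T => // x Kx; have [xk0|/ltW k0x] := leP (d x) (d k0).
  have := vmin x^T; rewrite trmxK; apply.
  by rewrite inE /A/= trmxK.
exact: le_trans vk0 k0x.
Qed.

(** * The bipolar theorem *)

(** The dual cone consists of row vectors, so that pairing with a vector is a
matrix product. *)
Definition dual_cone (R : realType) n (K : set 'cV[R]_n) : set 'rV[R]_n :=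
  [set f | forall y, K y -> 0 <= (f *m y) 0 0].

(** Let k be the point of K closest to z.  Moving from k inside K does not
decrease the distance to z, so p = k - z is nonnegative on every direction in
which one can move: all elements of K, and -k.  Hence p is in the dual cone and
p k <= 0, and the hypothesis p z >= 0 gives |p|^2 = p k - p z <= 0, so that
z = k. *)
Lemma bipolar (R : realType) n (K : set 'cV[R]_n) (z : 'cV[R]_n) :
  convex_cone K -> closed K -> K !=set0 ->
  (forall f, dual_cone K f -> 0 <= (f *m z) 0 0) -> K z.
Proof.
move=> [KD KZ] Kcl K0 fz; have [k Kk kmin] := closest_point z Kcl K0.
pose p := k - z.
have var h : (forall t : R, 0 < t -> t <= 1 -> K (k + t *: h)) ->
    0 <= (p^T *m h) 0 0.
  move=> Kh; suff : 0 <= 2 * (p^T *m h) 0 0 by lra.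
  apply: (@ge0_of_small_perturbation _ _ (sqnorm h)) => t t0 t1.
  have := kmin _ (Kh t t0 t1).
  by rewrite addrAC sqnormDZ lerDl pmulr_rge0.
have pK : dual_cone K p^T.
  by move=> y Ky; apply: var => t /ltW t0 _; apply: KD => //; exact: KZ.
have pk : 0 <= (p^T *m - k) 0 0.
  apply: var => t _ t1; rewrite scalerN -[X in X - _]scale1r -scalerBl.
  by apply: KZ => //; rewrite subr_ge0.
have pz := fz _ pK.
suff : p = 0 by move/eqP; rewrite subr_eq0 => /eqP <-.
apply: sqnorm_le0; move: pz pk; rewrite /sqnorm.
rewrite {3}/p mulmxN mulmxBr.
do !rewrite [fun_of_matrix (_ - _) _ _]mxE.
do !rewrite [fun_of_matrix (- _) _ _]mxE.
lra.
Qed.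

(** * Invertible matrices between cones *)

(** A set of row vectors with no common nonzero zero spans, so it contains a
basis.  Rows are added one by one: while the rows so far do not span, some
element of S is outside their span, for otherwise S would vanish on the columns
of their cokernel. *)
Lemma unitmx_rows_in (F : fieldType) n (S : set 'rV[F]_n) :
  (forall v : 'cV[F]_n, (forall f, S f -> f *m v = 0) -> v = 0) ->
  exists2 M : 'M[F]_n, M \in unitmx & forall i, S (row i M).
Proof.
move=> S0.
suff H k : (k <= n)%N ->
    exists2 M : 'M[F]_(k, n), row_free M & forall i, S (row i M).
  have [M Mf MS] := H n (leqnn n).
  by exists M => //; rewrite -row_free_unit.
elim: k => [_|k IH kn].
  exists 0; last by case.
  by rewrite /row_free mxrank0.
have [M Mf MS] := IH (ltnW kn).
have [f Sf fM] : exists2 f, S f & ~~ (f <= M)%MS.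
  apply: contrapT => nf.
  have SM f : S f -> f *m cokermx M = 0.
    move=> Sf; apply/eqP; rewrite -submxE; apply: contrapT => /negP fM.
    by apply: nf; exists f.
  have MC : cokermx M = 0.
    move: (cokermx M) SM => C SC; apply/matrixP => i j.
    have /colP/(_ i) : col j C = 0; last by rewrite !mxE.
    by apply: S0 => f Sf; rewrite colE mulmxA SC// mul0mx.
  move/eqP: MC; rewrite -mxrank_eq0 mxrank_coker (eqP Mf) subn_eq0.
  by rewrite leqNgt kn.
exists (col_mx f M : 'M[F]_(1 + k, n)).
  rewrite /row_free eqn_leq rank_leq_row/=.
  have fM' : (M < col_mx f M)%MS.
    rewrite /ltmx col_mx_sub (negbTE fM)/= andbT; apply/submxP.
    by exists (row_mx 0 1%:M); rewrite mul_row_col mul0mx mul1mx add0r.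
  by have := rank_ltmx fM'; rewrite (eqP Mf).
move=> i; case: (@split_ordP 1 k i) => j ->.
  by rewrite [row _ _](@rowKu _ 1 k n j f M) row_id.
by rewrite [row _ _](@rowKd _ 1 k n j f M).
Qed.

Lemma interior_perturb (R : realType) n (K : set 'cV[R]_n) (x v : 'cV[R]_n) :
  K° x -> exists2 e : R, 0 < e & K (x + e *: v).
Proof.
move=> Kx; have cv : x + e *: v @[e --> (0 : R)] --> x.
  rewrite -[X in _ --> X]addr0 -(scale0r v).
  by apply: cvgD; [exact: cvg_cst|apply: cvgZr_tmp; exact: cvg_id].
have /nbhs_ballP[r r0 rK] := cv _ Kx.
have r0' : 0 < r / 2 by rewrite divr_gt0.
exists (r / 2) => //; apply: rK; rewrite /ball/= sub0r normrN gtr0_norm//.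
by rewrite ltr_pdivrMr// ltr_pMr// ltr1n.
Qed.

(** K contains x + e f^T for some interior point x and some e > 0, so f kills
its own transpose. *)
Lemma annihilator_solid (R : realType) n (K : set 'cV[R]_n) (f : 'rV[R]_n) :
  K° !=set0 -> (forall x, K x -> f *m x = 0) -> f = 0.
Proof.
move=> [x Kx] f0; have [e e0 Ke] := interior_perturb f^T Kx.
have := f0 _ Ke; rewrite mulmxDr f0; last exact: interior_subset.
rewrite add0r -scalemxAr => /eqP; rewrite scaler_eq0 gt_eqF//= => /eqP ff.
rewrite -[f]trmxK (_ : f^T = 0) ?trmx0//; apply: sqnorm_le0.
by rewrite /sqnorm trmxK ff mxE.
Qed.

Section ProperCone.
Variables (R : realType) (n : nat) (K : set 'cV[R]_n).
Hypothesis KP : proper_cone K.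

Lemma proper_cone0 : K 0.
Proof.
case: KP => [[_ KZ] _ _ [x Kx]].
by rewrite -(scale0r x); apply: KZ => //; exact: interior_subset.
Qed.

Lemma proper_bipolar (z : 'cV[R]_n) :
  (forall f, dual_cone K f -> 0 <= (f *m z) 0 0) -> K z.
Proof.
by case: KP => Kc Kcl _ _; apply: bipolar => //; exists 0; exact: proper_cone0.
Qed.

Lemma proper_pointed (x : 'cV[R]_n) : K x -> K (- x) -> x = 0.
Proof.
case: KP => _ _ Kp _ Kx KNx.
suff : (K `&` [set - y | y in K]) x by rewrite Kp.
by split => //; exists (- x) => //; rewrite opprK.
Qed.

(** Both v and -v are in the bidual, so this is where pointedness of K enters:
it makes the dual cone span. *)
Lemma dual_separates (v : 'cV[R]_n) :
  (forall f, dual_cone K f -> f *m v = 0) -> v = 0.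
Proof.
by move=> v0; apply: proper_pointed; apply: proper_bipolar => f Kf;
  rewrite ?mulmxN v0// ?oppr0 mxE.
Qed.

Lemma unitmx_in_dual_cone :
  exists2 F : 'M[R]_n, F \in unitmx & forall i, dual_cone K (row i F).
Proof. exact: unitmx_rows_in dual_separates. Qed.

Lemma unitmx_in_proper_cone :
  exists2 U : 'M[R]_n, U \in unitmx & forall i, K (col i U).
Proof.
have [|U Uu KU] := unitmx_rows_in (S := [set f : 'rV[R]_n | K f^T]).
  move=> v v0; rewrite -[v]trmxK (_ : v^T = 0) ?trmx0//.
  apply: (@annihilator_solid _ _ K); first by case: KP.
  by move=> x Kx; rewrite -[x]trmxK -trmx_mul v0 ?trmx0//= trmxK.
by exists U^T; rewrite ?unitmx_tr// => i; rewrite -tr_row; exact: KU.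
Qed.

End ProperCone.

Definition cone_map (R : realType) n (K1 K2 : set 'cV[R]_n) (Z : 'M[R]_n) :=
  forall y, K1 y -> K2 (Z *m y).

(** For a basis u_i taken in K2 and a basis f_i taken in the dual of K1, the sum
of the rank one matrices u_i f_i is invertible and maps K1 into K2. *)
Lemma exists_unitmx_cone_map (R : realType) n (K1 K2 : set 'cV[R]_n) :
  proper_cone K1 -> proper_cone K2 ->
  exists2 Z : 'M[R]_n, Z \in unitmx & cone_map K1 K2 Z.
Proof.
move=> K1P K2P; have [F Fu KF] := unitmx_in_dual_cone K1P.
have [U Uu KU] := unitmx_in_proper_cone K2P.
exists (U *m F) => [|y Ky]; first by rewrite unitmx_mul Uu.
have -> : U *m F *m y = \sum_i (row i F *m y) 0 0 *: col i U.
  apply/colP => i; rewrite -mulmxA mxE summxE; apply: eq_bigr => j _.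
  by rewrite -row_mul !mxE mulrC.
have [[KD KZ] _ _ _] := K2P.
apply: (big_ind K2); [exact: proper_cone0|exact: KD|move=> i _].
by apply: KZ => //; exact: KF.
Qed.

(** * Minimal semipositivity in terms of the inverse *)

Lemma invmx_uniq (R : comUnitRingType) n (A B : 'M[R]_n) :
  B *m A = 1%:M -> invmx A = B.
Proof.
by move=> BA; have [_ Au] := mulmx1_unit BA; rewrite -[LHS]mul1mx -BA mulmxK.
Qed.

Lemma invmxM (R : comUnitRingType) n (A B : 'M[R]_n) :
  A \in unitmx -> B \in unitmx -> invmx (A *m B) = invmx B *m invmx A.
Proof.
by move=> Au Bu; apply: invmx_uniq; rewrite -mulmxA mulKmx// mulVmx.
Qed.

Lemma unitmxN (R : comUnitRingType) n (A : 'M[R]_n) :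
  (- A \in unitmx) = (A \in unitmx).
Proof. by rewrite -scaleN1r unitmxZ// unitrN1. Qed.

Lemma invmxN (R : comUnitRingType) n (A : 'M[R]_n) :
  A \in unitmx -> invmx (- A) = - invmx A.
Proof. by move=> Au; apply: invmx_uniq; rewrite mulmxN mulNmx opprK mulVmx. Qed.

(** For the converse, the preimage of K2 under A is a neighbourhood of the point
invmx A *m y with y interior to K2, and it is contained in K1; hence the point
is interior to K1 and witnesses semipositivity. *)
Lemma MS_invmxP (R : realType) n (K1 K2 : set 'cV[R]_n) (A : 'M[R]_n) :
  proper_cone K2 ->
  MS K1 K2 A <-> A \in unitmx /\ cone_map K2 K1 (invmx A).
Proof.
move=> [_ _ _ [y Ky]]; split=> [[_ [B BA BK]]|[Au AK]].
  have [Bu Au] := mulmx1_unit BA; split=> // x Kx.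
  rewrite (invmx_uniq BA).
  by apply: BK; exists x.
split; last by exists (invmx A); rewrite ?mulVmx// => _ [x Kx <-]; exact: AK.
exists (invmx A *m y); last by rewrite mulKVmx.
have : nbhs (invmx A *m y) (mulmx A @^-1` K2).
  by apply: mulmx_continuous; rewrite mulKVmx.
by apply: filterS => x /= /AK; rewrite mulKmx.
Qed.

(** * Rank one tests *)

(** For n > 0, the determinant of e Z + u f is, up to the unit e^(n-1) det Z,
equal to e + f Z^-1 u, so at most one nonzero e is bad.  The proof reads this
off a vector w in the left kernel: w is a multiple of f Z^-1, and the scalar
w u is then killed by e + f Z^-1 u. *)
Lemma unitmx_rank1_perturb (F : fieldType) n (Z : 'M[F]_n) (u : 'cV[F]_n)
    (f : 'rV[F]_n) (e : F) :
  Z \in unitmx -> e != 0 -> e != - (f *m invmx Z *m u) 0 0 ->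
  e *: Z + u *m f \in unitmx.
Proof.
move=> Zu e0 ec; rewrite -row_free_unit -kermx_eq0; apply/eqP/row_matrixP => i.
set w := row i _; rewrite row0.
have wM : w *m (e *: Z + u *m f) = 0.
  by apply/sub_kermxP; exact: row_sub.
have wuf : w *m u *m f = (w *m u) 0 0 *: f.
  by rewrite {1}[w *m u]mx11_scalar mul_scalar_mx.
have ewf : e *: w = - (w *m u) 0 0 *: (f *m invmx Z).
  move/(congr1 (mulmx^~ (invmx Z))): wM; rewrite mul0mx mulmxDr mulmxDl.
  rewrite -!scalemxAr -!scalemxAl mulmxK// mulmxA wuf -scalemxAl scaleNr.
  by move/eqP; rewrite addr_eq0 => /eqP.
have wu0 : (w *m u) 0 0 = 0.
  have := congr1 (fun v => (v *m u) 0 0) ewf.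
  rewrite -!scalemxAl.
  do !rewrite [fun_of_matrix (_ *: _) _ _]mxE.
  rewrite mulNr => /eqP; rewrite -addr_eq0 [(w *m u) 0 0 * _]mulrC -mulrDl.
  by rewrite mulf_eq0 addr_eq0 (negbTE ec) => /eqP.
move: ewf; rewrite wu0 oppr0 scale0r => /eqP.
by rewrite scaler_eq0 (negbTE e0) => /eqP.
Qed.

(** The matrix u f maps K2 into K1 but is in general singular.  It is the limit
for e tending to 0 of e Z + u f, with Z invertible mapping K2 into K1, and these
are invertible for small e > 0.  The limit is taken after pairing with an
element g of the dual of K1, where it is the limit of an affine function of
e. *)
Lemma cone_map_rank1 (R : realType) n (K1 K2 : set 'cV[R]_n) (P Q : 'M[R]_n) :
  proper_cone K1 -> proper_cone K2 ->
  (forall Z, Z \in unitmx -> cone_map K2 K1 Z ->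
    cone_map K2 K1 (P *m Z *m Q)) ->
  forall u f y, K1 u -> dual_cone K2 f -> K2 y ->
  K1 ((f *m (Q *m y)) 0 0 *: (P *m u)).
Proof.
move=> K1P K2P H u f y Ku Kf Ky.
have [Z Zu ZK] := exists_unitmx_cone_map K2P K1P.
have [[KD KZ] _ _ _] := K1P.
apply: (proper_bipolar K1P) => g Kg.
have -> : (f *m (Q *m y)) 0 0 *: (P *m u) = P *m (u *m f) *m Q *m y.
  rewrite -!mulmxA; rewrite [f *m (Q *m y)]mx11_scalar mul_mx_scalar.
  by rewrite scalemxAr mxE.
(* The only nonzero e at which e Z + u f may be singular is - c. *)
pose c : R := (f *m invmx Z *m u) 0 0.
have He e : 0 < e -> e != - c ->
    0 <= (g *m (P *m (u *m f) *m Q *m y)) 0 0 +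
         e * (g *m (P *m Z *m Q *m y)) 0 0.
  move=> e0 ec.
  have eZu := unitmx_rank1_perturb Zu (lt0r_neq0 e0) ec.
  have := Kg _ (H _ eZu _ _ Ky).
  rewrite mulmxDr !mulmxDl mulmxDr -scalemxAr -!scalemxAl -scalemxAr.
  do !rewrite [fun_of_matrix (_ + _) _ _]mxE.
  do !rewrite [fun_of_matrix (_ *: _) _ _]mxE.
  rewrite addrC; apply => x Kx; rewrite mulmxDl -scalemxAl; apply: KD.
    by apply: KZ; [exact: ltW|exact: ZK].
  rewrite -mulmxA [f *m x]mx11_scalar mul_mx_scalar; apply: KZ => //.
  exact: Kf.
have [c0|c0] := eqVneq c 0.
  apply: (@ge0_of_small_perturbation _ _ ((g *m (P *m Z *m Q *m y)) 0 0)).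
  by move=> t t0 _; apply: He => //; rewrite c0 oppr0 gt_eqF.
(* The values e = t |c| / 2 with 0 < t <= 1 all differ from - c. *)
have c0' : 0 < `|c| / 2 by rewrite divr_gt0 ?normr_gt0.
apply: (@ge0_of_small_perturbation _ _
  (`|c| / 2 * (g *m (P *m Z *m Q *m y)) 0 0)).
move=> t t0 t1; rewrite mulrA; apply: He; first exact: mulr_gt0.
apply/eqP => /(congr1 Num.norm); rewrite normrN gtr0_norm ?(mulr_gt0 t0)//.
by move: c0' t1; move: `|c| => b b0 t1; nra.
Qed.

(** * Matrices preserving minimal semipositivity *)

Lemma proper_neq0 (R : realType) n (K : set 'cV[R]_n) :
  (0 < n)%N -> proper_cone K -> exists2 u, K u & u != 0.
Proof.
move=> n0 [_ _ _ K0]; apply: contrapT => nK.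
have /matrixP/(_ 0 (Ordinal n0)) : const_mx 1 = 0 :> 'rV[R]_n.
  apply: (annihilator_solid K0) => x Kx.
  suff -> : x = 0 by rewrite mulmx0.
  by apply: contrapT => /eqP x0; apply: nK; exists x.
by rewrite !mxE => /eqP; rewrite oner_eq0.
Qed.

(** Dividing by a positive scalar f Q y shows that P preserves K1.  If another
scalar were negative, P u and - P u would be in K1 for a nonzero u in K1, hence
P u = 0, against invertibility of P.  So Q sends K2 into the bidual of K2. *)
Lemma cone_maps_of_pos (R : realType) n (K1 K2 : set 'cV[R]_n) (P Q : 'M[R]_n) :
  (0 < n)%N -> proper_cone K1 -> proper_cone K2 -> P \in unitmx ->
  (forall u f y, K1 u -> dual_cone K2 f -> K2 y ->
    K1 ((f *m (Q *m y)) 0 0 *: (P *m u))) ->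
  (exists f y, [/\ dual_cone K2 f, K2 y & 0 < (f *m (Q *m y)) 0 0]) ->
  cone_map K2 K2 Q /\ cone_map K1 K1 P.
Proof.
move=> n0 K1P K2P Pu PQ [f0 [y0 [Kf0 Ky0 s0]]].
have [[_ KZ] _ _ _] := K1P.
have PK : cone_map K1 K1 P.
  move=> u Ku; rewrite -[P *m u]scale1r -(mulVf (lt0r_neq0 s0)) -scalerA.
  by apply: KZ; [rewrite invr_ge0 ltW|exact: PQ].
split=> // y Ky; apply: (proper_bipolar K2P) => f Kf.
have [u Ku u0] := proper_neq0 n0 K1P.
rewrite leNgt; apply/negP => s1; move/eqP: u0; apply.
rewrite -(mulKmx Pu u) (_ : P *m u = 0) ?mulmx0//.
apply: (proper_pointed K1P); first exact: PK.
rewrite -scaleN1r -(mulVf (ltr0_neq0 s1)) -mulNr -scalerA.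
by apply: KZ; [rewrite oppr_ge0 invr_le0 ltW|exact: PQ].
Qed.

Lemma inverse_nonnegativeE (R : realType) n (K : set 'cV[R]_n) (Y : 'M[R]_n) :
  inverse_nonnegative K Y <-> Y \in unitmx /\ cone_map K K (invmx Y).
Proof.
split=> -[Yu YK]; split=> //; first by move=> x Kx; apply: YK; exists x.
by move=> _ [x Kx <-]; exact: YK.
Qed.

Lemma MS_two_sided_mul (R : realType) n (K1 K2 : set 'cV[R]_n)
    (X A Y : 'M[R]_n) :
  proper_cone K2 -> inverse_nonnegative K2 X -> inverse_nonnegative K1 Y ->
  MS K1 K2 A -> MS K1 K2 (X *m A *m Y).
Proof.
move=> K2P /inverse_nonnegativeE[Xu XK] /inverse_nonnegativeE[Yu YK].
move=> /(MS_invmxP _ _ K2P)[Au AK]; apply/(MS_invmxP _ _ K2P).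
rewrite !unitmx_mul Xu Au Yu; split=> // y Ky.
by rewrite !invmxM ?unitmx_mul ?Xu// -!mulmxA; apply/YK/AK/XK.
Qed.

Theorem theorem3p35 (R : realType) (n : nat) (K1 K2 : set 'cV[R]_n)
    (X Y : 'M[R]_n) :
  (2 <= n)%N -> proper_cone K1 -> proper_cone K2 ->
  ([set X *m A *m Y | A in MS K1 K2] `<=` MS K1 K2) <->
  (inverse_nonnegative K2 X /\ inverse_nonnegative K1 Y) \/
  (inverse_nonnegative K2 (- X) /\ inverse_nonnegative K1 (- Y)).
Proof.
move=> n2 K1P K2P; split=> [XY|]; last first.
  case=> [] [XK YK] _ [A AMS <-]; first exact: (MS_two_sided_mul K2P).
  rewrite -[X]opprK -[Y]opprK mulNmx mulmxN mulNmx opprK.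
  exact: (MS_two_sided_mul K2P).
have [Z Zu ZK] := exists_unitmx_cone_map K2P K1P.
have MSV Z' : Z' \in unitmx -> cone_map K2 K1 Z' -> MS K1 K2 (invmx Z').
  by move=> Z'u Z'K; apply/(MS_invmxP _ _ K2P); rewrite unitmx_inv invmxK.
have XYV Z' : Z' \in unitmx -> cone_map K2 K1 Z' ->
    MS K1 K2 (X *m invmx Z' *m Y).
  by move=> Z'u Z'K; apply: XY; exists (invmx Z') => //; exact: MSV.
(* The image of a single element, being invertible, has invertible factors. *)
have /(MS_invmxP _ _ K2P)[+ _] := XYV _ Zu ZK.
rewrite !unitmx_mul unitmx_inv Zu andbT => /andP[Xu Yu].
set P := invmx Y; set Q := invmx X.
have PZQ Z' : Z' \in unitmx -> cone_map K2 K1 Z' ->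
    cone_map K2 K1 (P *m Z' *m Q).
  move=> Z'u Z'K; have /(MS_invmxP _ _ K2P)[_] := XYV _ Z'u Z'K.
  rewrite !invmxM// ?invmxK ?unitmx_mul ?unitmx_inv ?Xu//.
  by rewrite mulmxA.
have fPu := cone_map_rank1 K1P K2P PZQ.
have n0 : (0 < n)%N by exact: leq_trans n2.
have [y Ky y0] := proper_neq0 n0 K2P.
have Qu : Q \in unitmx by rewrite unitmx_inv.
have [f Kf fQy] : exists2 f, dual_cone K2 f & (f *m (Q *m y)) 0 0 != 0.
  apply: contrapT => nf; move/eqP: y0; apply.
  rewrite -(mulKmx Qu y) (_ : Q *m y = 0) ?mulmx0//.
  apply: (dual_separates K2P) => f Kf; rewrite [LHS]mx11_scalar.
  suff -> : (f *m (Q *m y)) 0 0 = 0 by rewrite raddf0.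
  by apply: contrapT => /eqP fQy; apply: nf; exists f.
case/lt_total/orP: fQy => [fQy|fQy]; [right|left].
  rewrite !inverse_nonnegativeE !invmxN// -/P -/Q.
  have [|||QK PK] := @cone_maps_of_pos _ _ K1 K2 (- P) (- Q) n0 K1P K2P.
  - by rewrite unitmxN unitmx_inv.
  - move=> u g x Ku Kg Kx.
    by rewrite !mulNmx mulmxN mxE scalerN scaleNr opprK; exact: fPu.
  - by exists f, y; split=> //; rewrite mulNmx mulmxN mxE oppr_gt0.
  by rewrite !unitmxN.
rewrite !inverse_nonnegativeE -/P -/Q.
have [||QK PK] := @cone_maps_of_pos _ _ K1 K2 P Q n0 K1P K2P _ fPu.
- by rewrite unitmx_inv.
- by exists f, y.
by [].
Qed.
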